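(* Let $\gamma\sqrt{d}\geq 12800$, let $x^*\in\{\pm1\}^n$ be balanced, and let $\zeta\geq 2\exp\!\left(-\frac{\gamma^2 d}{512}\right)$. Let $\epsilon\geq \frac{64\log(2/\zeta)}{\gamma d}$. Then: (1) If additionally $\zeta\leq e^{-640}$, there exists an $\epsilon$-differentially edge private algorithm (i.e. $(\epsilon,0)$-private) which on input $\mathbf{G}\sim\mathrm{SBM}_n(d,\gamma,x^* )$ outputs $\hat{x}(\mathbf{G})\in\{\pm1\}^n$ satisfying $\mathrm{err}(\hat{x}(\mathbf{G}),x^* )\leq\zeta$ with probability at least $1-\zeta$. (2) There exists an $\epsilon$-differentially edge private algorithm which on input $\mathbf{G}\sim\mathrm{SBM}_n(d,\gamma,x^* )$ outputs $\hat{x}(\mathbf{G})\in\{\pm1\}^n$ satisfying $\mathrm{err}(\hat{x}(\mathbf{G}),x^* )\leq 20/\sqrt{\log(1/\zeta)}$ with probability at least $1-e^{-n}$.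
   Context: Stochastic block model: for $n\in\mathbb{N}$, $d>0$, $\gamma>0$ and $x\in\{\pm1\}^n$, $\mathbf{G}\sim\mathrm{SBM}_n(d,\gamma,x)$ is the random graph on vertex set $[n]$ in which each pair $\{i,j\}$ of distinct vertices is independently an edge with probability $(1+\gamma x_i x_j)\frac{d}{n}$ (parameters are assumed such that these are probabilities). A vector $x\in\{\pm1\}^n$ is balanced if $\sum_i x_i=0$. For $u,v\in\{\pm1\}^n$, $\mathrm{Ham}(u,v)$ is the number of coordinates where they differ and $\mathrm{err}(u,v):=\frac1n\min\{\mathrm{Ham}(u,v),\mathrm{Ham}(u,-v)\}$. Two graphs on vertex set $[n]$ are adjacent if their edge sets differ in exactly one edge; an algorithm $\mathcal M$ is $\epsilon$-differentially edge private if for all adjacent $G,G'$ and all output sets $S$, $\Pr[\mathcal M(G)\in S]\leq e^{\epsilon}\Pr[\mathcal M(G')\in S]$. The parameters $n,d,\gamma$ are public. *)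

(* Defs.v *)
From mathcomp Require Import all_boot all_order all_algebra.
From mathcomp Require Import reals sequences exp.

Set Implicit Arguments.
Unset Strict Implicit.
Unset Printing Implicit Defensive.

Import Order.TTheory GRing.Theory Num.Theory.
Local Open Scope ring_scope.

Record fdist (R : realType) (T : finType) := FDist {
  pmf :> {ffun T -> R};
  pmf_ge0 : forall t, 0 <= pmf t;
  pmf_sum1 : \sum_t pmf t = 1 }.

Definition Pr (R : realType) (T : finType) (P : fdist R T) (S : {set T}) : R :=
  \sum_(t in S) P t.

Section Bind.
Variables (R : realType) (T U : finType) (P : fdist R T) (K : T -> fdist R U).

Definition bind_pmf : {ffun U -> R} := [ffun u => \sum_t P t * K t u].

Lemma bind_ge0 u : 0 <= bind_pmf u.
Proof. by rewrite ffunE sumr_ge0 // => t _; rewrite mulr_ge0 ?pmf_ge0. Qed.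

Lemma bind_sum1 : \sum_u bind_pmf u = 1.
Proof.
under eq_bigr do rewrite ffunE.
rewrite exchange_big /= -[RHS](pmf_sum1 P).
by apply: eq_bigr => t _; rewrite -mulr_sumr pmf_sum1 mulr1.
Qed.

(* Law of the output of the randomized map K run on an input drawn from P,
   the internal randomness of K being independent of the input. *)
Definition fbind : fdist R U := FDist bind_ge0 bind_sum1.
End Bind.

(* The unordered pair {i, j} of distinct vertices is encoded by (i, j), i < j;
   a simple graph on [n] is its edge set. *)
Definition vpair (n : nat) := {p : 'I_n * 'I_n | (p.1 < p.2)%N}.
Definition graph (n : nat) := {set vpair n}.

Definition adjacent (n : nat) (G H : graph n) : Prop :=
  #|(G :\: H) :|: (H :\: G)| = 1%N.

(* An element of {+1, -1}^n, with false standing for +1 and true for -1. *)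
Definition signs (n : nat) := {ffun 'I_n -> bool}.
Definition spin (n : nat) (x : signs n) (i : 'I_n) : int := (-1) ^+ x i.
Definition opp_signs (n : nat) (x : signs n) : signs n := [ffun i => ~~ x i].

Definition balanced (n : nat) (x : signs n) : Prop := \sum_i spin x i = 0.

Definition Ham (n : nat) (u v : signs n) : nat := #|[set i | u i != v i]|.

Definition err (R : realType) (n : nat) (u v : signs n) : R :=
  n%:R^-1 * (minn (Ham u v) (Ham u (opp_signs v)))%:R.

Definition edge_prob (R : realType) (n : nat) (d gamma : R) (x : signs n)
    (i j : 'I_n) : R :=
  (1 + gamma * (spin x i * spin x j)%:~R) * (d / n%:R).

Definition sbm_valid (R : realType) (n : nat) (d gamma : R) (x : signs n) :=
  forall i j : 'I_n, i != j -> 0 <= edge_prob d gamma x i j <= 1.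

Section SBM.
Variables (R : realType) (n : nat) (d gamma : R) (x : signs n).
Hypothesis valid : sbm_valid d gamma x.

Definition sbm_pmf : {ffun graph n -> R} := [ffun G : graph n =>
  \prod_(e : vpair n)
    let p := edge_prob d gamma x (val e).1 (val e).2 in
    if e \in G then p else 1 - p].

Lemma sbm_ge0 G : 0 <= sbm_pmf G.
Proof.
rewrite ffunE prodr_ge0 // => -[[i j] /= lt_ij] _.
have /valid/andP[p_ge0 p_le1] : i != j by rewrite neq_ltn lt_ij.
by case: ifP; rewrite ?subr_ge0.
Qed.

Lemma sbm_sum1 : \sum_G sbm_pmf G = 1.
Proof.
under eq_bigr do rewrite ffunE.
rewrite -bigA_distr big1 // => e _.
by rewrite /= addrCA subrr addr0.
Qed.

Definition sbm : fdist R (graph n) := FDist sbm_ge0 sbm_sum1.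
End SBM.

(* A randomized algorithm taking a graph on [n] to a vector in {+1, -1}^n. *)
Definition algorithm (R : realType) (n : nat) := graph n -> fdist R (signs n).

Definition edge_private (R : realType) (n : nat) (eps : R)
    (M : algorithm R n) : Prop :=
  forall G H : graph n, adjacent G H -> forall S : {set signs n},
    Pr (M G) S <= expR eps * Pr (M H) S.

(* Main.v *)
(* Run the exponential mechanism with score
     s_G(y) = \sum_(i < j) y_i y_j ([ij \in G] - d / n)
   and weights expR (lambda s_G(y) / 2), lambda = 64 ln (2 / zeta) / (gamma d).
   Flipping one edge changes the score by at most 1, so the mechanism is
   lambda-private. For true labels x, the probability of outputting y is at most
   E expR (lambda (s_G(y) - s_G(x)) / 2), which factors over pairs; each of the
   k (n - k) pairs on which y and x disagree, k = Ham y x, contributes at most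
   expR (- gamma lambda d / (2 n)). As k (n - k) >= min(k, n - k) n / 2, this is
   at most a ^ (16 min(k, n - k)) with a = zeta / 2. Only a ^ min(k, n - k) is
   spent on the union bound, through \sum_y a ^ Ham y x = (1 + a) ^ n; the
   other 15 powers give the failure probability. *)
Require Import Defs.
From mathcomp Require Import all_boot all_order all_algebra.
From mathcomp Require Import reals sequences exp.
From mathcomp Require Import ring lra zify.

Set Implicit Arguments.
Unset Strict Implicit.
Unset Printing Implicit Defensive.

Import Order.TTheory GRing.Theory Num.Theory.
Local Open Scope ring_scope.

(** * Elementary estimates *)

Lemma expR_le_quadratic (R : realType) (u : R) :
  u <= 2^-1 -> expR u <= 1 + u + 2 * u ^+ 2.
Proof.
move=> u_le.
have := expR_ge1Dx (- u); rewrite expRN => h.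
have eu_gt0 := expR_gt0 u.
have h1 : (1 - u) * expR u <= 1.
  by rewrite -ler_pdivlMr // div1r.
(* Since [expR u] is at most [1 / (1 - u)], it remains to bound this reciprocal by the quadratic. *)
have h2 : 1 <= (1 - u) * (1 + u + 2 * u ^+ 2).
  have -> : (1 - u) * (1 + u + 2 * u ^+ 2) = 1 + u ^+ 2 * (1 - 2 * u) by ring.
  by rewrite lerDl mulr_ge0 ?sqr_ge0 //; lra.
by rewrite -(ler_pM2l (_ : 0 < 1 - u)) ?(le_trans h1 h2) //; lra.
Qed.

Lemma Pr_setC (R : realType) (T : finType) (P : fdist R T) (S : {set T}) :
  Pr P S = 1 - Pr P (~: S).
Proof.
rewrite -(pmf_sum1 P) (bigID (mem S)) /= /Pr.
under [in X in _ - X]eq_bigl do rewrite inE.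
by rewrite addrK.
Qed.

(** * The exponential mechanism on a finite set *)

Section Gibbs.
Variables (R : realType) (T : finType) (t0 : T) (beta : R).
Implicit Type s : T -> R.

Definition gibbs_sum s : R := \sum_t expR (beta * s t).

Lemma gibbs_sum_gt0 s : 0 < gibbs_sum s.
Proof.
rewrite /gibbs_sum (bigD1 t0) //= ltr_wpDr ?expR_gt0 //.
by apply: sumr_ge0 => t _; apply: expR_ge0.
Qed.

Definition gibbs_pmf s : {ffun T -> R} :=
  [ffun t => expR (beta * s t) / gibbs_sum s].

Lemma gibbs_ge0 s t : 0 <= gibbs_pmf s t.
Proof. by rewrite ffunE divr_ge0 ?expR_ge0 // ltW // gibbs_sum_gt0. Qed.

Lemma gibbs_sum1 s : \sum_t gibbs_pmf s t = 1.
Proof.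
under eq_bigr do rewrite ffunE.
by rewrite -mulr_suml mulfV // lt0r_neq0 // gibbs_sum_gt0.
Qed.

Definition gibbs s : fdist R T := FDist (gibbs_ge0 s) (gibbs_sum1 s).

(** The normalising sum is at least its single term at [u]. With [u] the true labels, this removes
    the only factor that does not split over pairs. *)
Lemma gibbs_le_ratio s t u : gibbs s t <= expR (beta * (s t - s u)).
Proof.
rewrite ffunE mulrBr expRB ler_wpM2l ?expR_ge0 //.
rewrite lef_pV2 ?posrE ?expR_gt0 ?gibbs_sum_gt0 //.
rewrite /gibbs_sum (bigD1 u) //= lerDl.
by apply: sumr_ge0 => v _; apply: expR_ge0.
Qed.

(** One factor [expR beta] pays for the change of the weight, a second one for the change of the
    normalising sum. *)
Lemma gibbs_stable s s' (S : {set T}) :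
  0 <= beta -> (forall t, `|s t - s' t| <= 1) ->
  Pr (gibbs s) S <= expR (2 * beta) * Pr (gibbs s') S.
Proof.
move=> beta_ge0 s_close.
have weight_le r r' t : `|r t - r' t| <= 1 ->
    expR (beta * r t) <= expR beta * expR (beta * r' t).
  move=> rr'; rewrite -expRD ler_expR -{2}(mulr1 beta) -mulrDr.
  rewrite ler_wpM2l // -lerBlDr; exact: le_trans (ler_norm _) rr'.
rewrite /Pr mulr_sumr; apply: ler_sum => t _; rewrite !ffunE.
have -> : expR (2 * beta) = expR beta * expR beta.
  by rewrite -expRD mulr_natl mulr2n.
rewrite [expR beta * expR beta * _]mulrACA.
rewrite ler_pM ?expR_ge0 ?invr_ge0 ?(ltW (gibbs_sum_gt0 _)) ?weight_le //.
rewrite ler_pdivlMr ?gibbs_sum_gt0 // mulrC ler_pdivrMr ?gibbs_sum_gt0 //.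
rewrite /gibbs_sum mulr_sumr; apply: ler_sum => u _.
by rewrite weight_le // distrC.
Qed.
End Gibbs.

(** * The score and its privacy *)

Lemma spin_mul (n : nat) (y : signs n) i j :
  spin y i * spin y j = (-1) ^+ (y i (+) y j).
Proof. by rewrite /spin signr_addb. Qed.

Section Score.
Variables (R : realType) (n : nat) (d : R).

Definition pair_spin (y : signs n) (e : vpair n) : R :=
  (spin y (val e).1 * spin y (val e).2)%:~R.

(* Centring the edges at d / n makes every pair separated by y and x contribute
   a drift towards x, so y need not be restricted to balanced vectors. *)
Definition score (G : graph n) (y : signs n) : R :=
  \sum_e pair_spin y e * ((e \in G)%:R - d / n%:R).

Lemma pair_spinE y e :
  pair_spin y e = (-1) ^+ (y (val e).1 (+) y (val e).2).
Proof. by rewrite /pair_spin spin_mul rmorph_sign. Qed.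

Lemma score_adjacent G H y : Defs.adjacent G H -> `|score G y - score H y| <= 1.
Proof.
move=> adjGH; rewrite /score -sumrB.
apply: le_trans (ler_norm_sum _ _ _) _.
(* Writing 1 as the size of the symmetric difference allows a comparison pair by pair. *)
rewrite -[leRHS](_ : #|(G :\: H) :|: (H :\: G)|%:R = 1); last by rewrite adjGH.
rewrite -sum1_card natr_sum [leRHS]big_mkcond /=; apply: ler_sum => e _.
rewrite -mulrBr normrM pair_spinE normr_sign mul1r !inE.
by case: (e \in G); case: (e \in H); rewrite /= ler_norml; lra.
Qed.

(** The halving offsets the factor 2 in [gibbs_stable]; the constant labelling witnesses that the
    output set is nonempty. *)
Definition sbm_mechanism (lambda : R) : algorithm R n :=
  fun G => gibbs [ffun=> false] (lambda / 2) (score G).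

Lemma sbm_mechanism_private lambda eps : 0 <= lambda -> lambda <= eps ->
  edge_private eps (sbm_mechanism lambda).
Proof.
move=> l_ge0 l_le G H adjGH S.
have := gibbs_stable [ffun=> false] S (divr_ge0 l_ge0 (ler0n R 2))
  (fun y => score_adjacent y adjGH).
rewrite (mulrC 2) divfK ?pnatr_eq0 // => /le_trans -> //.
rewrite ler_wpM2r ?ler_expR // /Pr sumr_ge0 // => y _.
exact: pmf_ge0.
Qed.
End Score.

(** * Expected weight ratio under the block model *)

Lemma edge_factor_le (R : realType) (b : bool) (lambda delta gamma : R) :
  let p := (1 + gamma * (-1) ^+ b) * delta in
  0 <= lambda -> lambda <= gamma / 8 -> gamma <= 1 -> 0 <= delta -> 0 <= p ->
  p * expR (- lambda * (-1) ^+ b * (1 - delta))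
    + (1 - p) * expR (- lambda * (-1) ^+ b * (0 - delta))
  <= expR (- (gamma * lambda * delta / 2)).
Proof.
move=> p l_ge0 l_le g_le1 delta_ge0 p_ge0.
(* [s] is the product of the two true spins of a pair on which the labellings disagree, [p] its edge
   probability and [delta] stands for [d / n]. *)
set s : R := (-1) ^+ b.
have s2 : s ^+ 2 = 1 by rewrite sqrr_sign.
have -> : - lambda * s * (1 - delta) = lambda * s * delta + (- lambda * s).
  by ring.
have -> : - lambda * s * (0 - delta) = lambda * s * delta by ring.
rewrite expRD.
have -> t u : p * (t * u) + (1 - p) * t = t * (1 + p * (u - 1)) :> R by ring.
have eq_le : expR (- lambda * s) - 1 <= - lambda * s + 2 * lambda ^+ 2.
  rewrite lerBlDl addrA (le_trans (expR_le_quadratic _)) //.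
    by rewrite /s; case: b {p p_ge0 s s2}; rewrite ?expr0 ?expr1; lra.
  by rewrite exprMn s2 mulr1 sqrrN.
apply: le_trans (_ : _ <= expR (lambda * s * delta)
    * expR (p * (- lambda * s + 2 * lambda ^+ 2))) _.
  rewrite ler_wpM2l ?expR_ge0 // (le_trans _ (expR_ge1Dx _)) //.
  by rewrite lerD2l ler_wpM2l.
rewrite -expRD ler_expR.
(* Centring cancels the part of the first-order term that depends on [s], leaving the drift
   [- gamma * lambda * delta]. As [1 + gamma * s <= 2] and [lambda <= gamma / 8], the quadratic term
   costs at most half of it. *)
have -> : lambda * s * delta + p * (- lambda * s + 2 * lambda ^+ 2) =
    delta * (- gamma * lambda * s ^+ 2 + 2 * (1 + gamma * s) * lambda ^+ 2).
  by rewrite /p -/s; ring.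
rewrite s2 mulr1 [leRHS](_ : _ = delta * (- gamma * lambda / 2)); last by ring.
rewrite ler_wpM2l //.
have gs_le1 : gamma * s <= 1.
  by rewrite /s; case: b {p p_ge0 s s2 eq_le}; rewrite ?expr0 ?expr1; lra.
have : lambda * lambda <= gamma / 8 * lambda by rewrite ler_wpM2r.
have : (1 - gamma * s) * lambda ^+ 2 >= 0 by rewrite mulr_ge0 ?sqr_ge0 //; lra.
rewrite expr2; lra.
Qed.

Definition cut (n : nat) (x y : signs n) : {set vpair n} :=
  [set e | (x (val e).1 (+) x (val e).2) != (y (val e).1 (+) y (val e).2)].

(** A pair lies in the cut exactly when one of its endpoints is in the set [D] of vertices where [x]
    and [y] differ and the other is not. *)
Lemma card_cut (n : nat) (x y : signs n) :
  #|cut x y| = (Ham x y * (n - Ham x y))%N.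
Proof.
set D := [set i | x i != y i].
have -> : (n - Ham x y)%N = #|~: D| by rewrite cardsCs setCK card_ord.
rewrite -[Ham x y]/(#|D|) -cardsX.
pose low := [set p : 'I_n * 'I_n | (p.1 < p.2)%N].
pose sw (p : 'I_n * 'I_n) := (p.2, p.1).
have sw_inj : injective sw by move=> [a b] [c e] [-> ->].
(* Pairs are stored in increasing order, so the decreasing part of [D] times its complement is
   swapped; it stays disjoint from the rest, its first coordinate now being outside [D]. *)
rewrite -(cardsID low (setX D (~: D))).
rewrite -[in RHS](card_imset (setX D (~: D) :\: low) sw_inj).
rewrite -cardsUI [X in (_ + X)%N](_ : _ = 0%N) ?addn0; last first.
  apply/eqP; rewrite cards_eq0; apply/eqP/setP => -[i j]; rewrite !inE /=.
  apply/negP => /andP[/andP[/andP[iD jD] _] /imsetP[[k l]]].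
  by rewrite !inE /= => /andP[_ /andP[kD _]] [_ ej]; rewrite ej kD in jD.
rewrite -(card_imset _ val_inj); apply: eq_card => -[i j].
apply/imsetP/idP => [[[[k l] kl]]|].
  rewrite !inE /= => cutkl [-> ->].
  case: (boolP (k \in D)) => kD.
    apply/orP; left; move: kD cutkl; rewrite !inE.
    by case: (x k) (y k) (x l) (y l) => [] [] [] [].
  apply/orP; right; apply/imsetP; exists (l, k) => //.
  rewrite !inE /= -leqNgt (ltnW kl) /=; move: kD cutkl; rewrite !inE.
  by case: (x k) (y k) (x l) (y l) => [] [] [] [].
rewrite !inE /= => /orP[/andP[/andP[iD jD] ij]|/imsetP[[k l]]].
  exists (Sub (i, j) ij) => //; rewrite !inE /=.
  by move: iD jD; case: (x i) (y i) (x j) (y j) => [] [] [] [].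
rewrite !inE /= -leqNgt => /andP[lk /andP[kD lD]] [-> ->].
have {}lk : (l < k)%N.
  by rewrite ltn_neqAle lk andbT; apply: contraNneq lD => /val_inj ->.
exists (Sub (l, k) lk) => //; rewrite !inE /=.
by move: kD lD; case: (x k) (y k) (x l) (y l) => [] [] [] [].
Qed.

Lemma expectation_ratio_le (R : realType) (n : nat) (d gamma lambda : R)
    (x y : signs n) (valid : sbm_valid d gamma x) :
  0 <= d -> 0 <= lambda -> lambda <= gamma / 8 -> gamma <= 1 ->
  \sum_G sbm valid G * expR (lambda / 2 * (score d G y - score d G x))
    <= expR (- (gamma * lambda * (d / n%:R) / 2)) ^+ #|cut y x|.
Proof.
move=> d_ge0 l_ge0 l_le g_le1.
pose p (e : vpair n) := edge_prob d gamma x (val e).1 (val e).2.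
pose w (e : vpair n) b : R :=
  expR (lambda / 2 * ((pair_spin R y e - pair_spin R x e) * (b - d / n%:R))).
have -> : \sum_G sbm valid G * expR (lambda / 2 * (score d G y - score d G x))
    = \sum_(G : graph n) \prod_e
        (if e \in G then p e * w e 1 else (1 - p e) * w e 0).
  apply: eq_bigr => G _; rewrite ffunE /score -sumrB mulr_sumr expR_sum.
  rewrite -big_split /=; apply: eq_bigr => e _.
  by rewrite -mulrBl; case: (e \in G).
(* Independence of the edges: the sum over graphs becomes a product over pairs of two-term sums.
   Pairs outside the cut give the factor 1. *)
rewrite -bigA_distr -prodr_const [leRHS]big_mkcond /=.
apply: ler_prod => -[[i j] /= ij] _.
have /valid/andP[p_ge0 p_le1] : i != j by rewrite neq_ltn ij.
apply/andP; split.
  by rewrite addr_ge0 // mulr_ge0 ?expR_ge0 ?subr_ge0.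
rewrite /p /w !pair_spinE inE /=.
rewrite /edge_prob spin_mul rmorph_sign in p_ge0 p_le1 *.
case: eqVneq => [->|neq] /=.
  by rewrite subrr !mul0r mulr0 expR0 !mulr1 addrCA subrr addr0.
(* Opposite signs differ by twice the sign of [x], which absorbs the halving of [lambda]. *)
have flip (t : R) : lambda / 2 * (((-1) ^+ (y i (+) y j)
    - (-1) ^+ (x i (+) x j)) * t) = - lambda * (-1) ^+ (x i (+) x j) * t.
  by move: neq; case: (x i (+) x j); case: (y i (+) y j) => //= _;
    rewrite ?expr0 ?expr1; field.
rewrite !flip.
by apply: edge_factor_le; rewrite ?divr_ge0.
Qed.

(** * Union bound over labellings *)

Lemma Ham_opp (n : nat) (y x : signs n) :
  Ham y (opp_signs x) = (n - Ham y x)%N.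
Proof.
have := cardsC [set i | y i != x i]; rewrite card_ord => n_eq.
rewrite /Ham -[X in (X - _)%N]n_eq addKn.
by apply: eq_card => i; rewrite !inE ffunE; case: (y i) (x i) => [] [].
Qed.

(** The coordinates of [y] are chosen independently, each giving 1 if it agrees with [x] and [a]
    otherwise. *)
Lemma sum_expr_Ham (R : realType) (n : nat) (a : R) (x : signs n) :
  \sum_y a ^+ Ham y x = (1 + a) ^+ n.
Proof.
transitivity (\prod_i \sum_b (if b != x i then a else 1)).
  rewrite bigA_distr_bigA; apply: eq_bigr => y _ /=.
  by rewrite -prodr_const big_mkcond; apply: eq_bigr => i _; rewrite inE.
rewrite -[RHS](_ : \prod_(i < n) (1 + a) = _); last first.
  by rewrite prodr_const card_ord.
apply: eq_bigr => i _; rewrite big_bool /=.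
by case: (x i); rewrite //= addrC.
Qed.

(** Balance yields two vertices of opposite sign; their edge probability [(1 - gamma) * d / n] must
    be nonnegative. *)
Lemma balanced_valid_gamma_le1 (R : realType) (n : nat) (d gamma : R)
    (x : signs n) :
  (0 < n)%N -> 0 < d -> sbm_valid d gamma x -> balanced x -> gamma <= 1.
Proof.
move=> n_gt0 d_gt0 valid bal.
pose i := Ordinal n_gt0.
have [j neq_ij] : exists j, x j != x i.
  apply/existsP; apply: contraPT bal => /existsPn same.
  rewrite /balanced (eq_bigr (fun=> spin x i)); last first.
    by move=> j _; rewrite /spin; have := same j; rewrite negbK => /eqP ->.
  rewrite sumr_const card_ord => /eqP.
  by rewrite mulrn_eq0 signr_eq0 orbF => /eqP n0; have := n_gt0; rewrite {1}n0.
have : i != j by apply: contraNneq neq_ij => ->.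
move=> /valid/andP[+ _]; rewrite /edge_prob spin_mul.
have -> : x i (+) x j = true by move: neq_ij; case: (x i) (x j) => [] [].
rewrite pmulr_lge0 ?divr_gt0 ?ltr0n // expr1 mulrN1z mulrN1; lra.
Qed.

Lemma mechanism_pmf_le (R : realType) (n : nat) (d gamma lambda : R)
    (x y : signs n) (valid : sbm_valid d gamma x) :
  (0 < n)%N -> 0 <= d -> 0 <= lambda -> lambda <= gamma / 8 -> gamma <= 1 ->
  fbind (sbm valid) (sbm_mechanism d lambda) y
    <= expR (- (gamma * lambda * d / 4))
         ^+ minn (Ham y x) (Ham y (opp_signs x)).
Proof.
move=> n_gt0 d_ge0 l_ge0 l_le g_le1.
rewrite ffunE; apply: le_trans (_ : \sum_G sbm valid G
    * expR (lambda / 2 * (score d G y - score d G x)) <= _).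
  apply: ler_sum => G _; rewrite ler_wpM2l ?pmf_ge0 //.
  exact: gibbs_le_ratio.
apply: le_trans (expectation_ratio_le y valid d_ge0 l_ge0 l_le g_le1) _.
rewrite -!expRM_natl ler_expR card_cut Ham_opp.
set h := Ham y x; set k := minn h (n - h).
have h_le : (h <= n)%N by rewrite (leq_trans (max_card _)) ?card_ord.
(* The larger of [h] and [n - h] is at least [n / 2]. *)
have k_le : (k * n <= 2 * (h * (n - h)))%N.
  rewrite /k; nia.
rewrite !mulrN lerN2.
have {}k_le : k%:R * n%:R <= 2 * (h * (n - h))%:R :> R.
  by rewrite -!natrM ler_nat.
have n_gt0' : 0 < n%:R :> R by rewrite ltr0n.
have c_ge0 : 0 <= gamma * lambda * d / 4 / n%:R.
  by rewrite !divr_ge0 ?mulr_ge0 ?ler0n //; lra.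
have := ler_wpM2r c_ge0 k_le.
have -> : k%:R * n%:R * (gamma * lambda * d / 4 / n%:R)
   = k%:R * (gamma * lambda * d / 4) by field; rewrite lt0r_neq0.
by move=> /le_trans -> //; rewrite le_eqVlt; apply/orP; left; apply/eqP; field;
  rewrite lt0r_neq0.
Qed.

(** Common to both regimes: [B] bounds the 15 powers kept from the union bound at every error above
    [theta]. The factor 2 accounts for [x] and its opposite. *)
Lemma mechanism_accuracy (R : realType) (n : nat) (d gamma lambda a theta B : R)
    (x : signs n) (valid : sbm_valid d gamma x) :
  (0 < n)%N -> 0 < d -> 0 <= lambda -> lambda <= gamma / 8 -> balanced x ->
  0 <= a -> 0 <= B -> expR (- (gamma * lambda * d / 4)) = a ^+ 16 ->
  (forall k : nat, theta * n%:R < k%:R -> a ^+ (15 * k) <= B) ->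
  1 - 2 * B * (1 + a) ^+ n <=
    Pr (fbind (sbm valid) (sbm_mechanism d lambda))
       [set y | err R y x <= theta].
Proof.
move=> n_gt0 d_gt0 l_ge0 l_le bal a_ge0 B_ge0 ha hB.
have g_le1 := balanced_valid_gamma_le1 n_gt0 d_gt0 valid bal.
rewrite Pr_setC lerD2l lerN2 /Pr; set S := ~: _.
apply: le_trans (_ : \sum_(y in S)
    B * (a ^+ Ham y x + a ^+ Ham y (opp_signs x)) <= _).
  apply: ler_sum => y; rewrite !inE -ltNge /err mulrC.
  rewrite ltr_pdivlMr ?ltr0n // => /hB k_le.
  apply: le_trans (mechanism_pmf_le y valid n_gt0 (ltW d_gt0) l_ge0 l_le g_le1) _.
  rewrite ha -exprM mulSn addnC exprD ler_pM ?exprn_ge0 //.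
  (* The power at the minimum is one of the two summands. *)
  by rewrite /minn; case: ifP => _; rewrite ?lerDl ?lerDr exprn_ge0.
rewrite big_mkcond /=; apply: le_trans (_ : \sum_y
    B * (a ^+ Ham y x + a ^+ Ham y (opp_signs x)) <= _).
  apply: ler_sum => y _; case: ifP => // _.
  by rewrite mulr_ge0 // addr_ge0 ?exprn_ge0.
rewrite -mulr_sumr big_split /= !sum_expr_Ham; lra.
Qed.

(** * Choice of parameters in the two regimes *)

Theorem theorem5p18 (R : realType) (n : nat) (d gamma zeta eps : R)
  (n_gt0 : (0 < n)%N) (d_gt0 : 0 < d) (gamma_gt0 : 0 < gamma)
  (snr : 12800 <= gamma * Num.sqrt d)
  (zeta_ge : 2 * expR (- (gamma ^+ 2 * d / 512)) <= zeta)
  (zeta_lt1 : zeta < 1)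
  (eps_ge : 64 * ln (2 / zeta) / (gamma * d) <= eps) :
  (zeta <= expR (- 640) ->
   exists M : algorithm R n, edge_private eps M /\
     forall (x : signs n) (valid : sbm_valid d gamma x), balanced x ->
       1 - zeta <=
         Pr (fbind (sbm valid) M) [set y : signs n | err R y x <= zeta])
  /\
  (exists M : algorithm R n, edge_private eps M /\
     forall (x : signs n) (valid : sbm_valid d gamma x), balanced x ->
       1 - expR (- n%:R) <=
         Pr (fbind (sbm valid) M)
           [set y : signs n | err R y x <= 20 / Num.sqrt (ln (1 / zeta))]).
Proof.
have zeta_gt0 : 0 < zeta by apply: lt_le_trans zeta_ge; rewrite mulr_gt0 ?expR_gt0.
have gd_gt0 : 0 < gamma * d by rewrite mulr_gt0.
set l := ln (2 / zeta).
(* The lower bound on [zeta] in logarithmic form; it is precisely what makes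
   [lambda <= gamma / 8]. *)
have l_le : l <= gamma ^+ 2 * d / 512.
  rewrite -ler_expR lnK ?posrE ?divr_gt0 //.
  rewrite ler_pdivrMr // -ler_pdivrMl ?expR_gt0 // -expRN.
  by rewrite mulrC.
have aE : expR (- l) = zeta / 2.
  by rewrite expRN lnK ?posrE ?divr_gt0 // invf_div.
have l_ge : 1 / 2 <= l by have := expR_ge1Dx (- l); rewrite aE; lra.
pose lambda := 64 * l / (gamma * d).
have lambda_ge0 : 0 <= lambda by rewrite divr_ge0 ?(ltW gd_gt0) //; lra.
have lambda_le : lambda <= gamma / 8.
  rewrite ler_pdivrMr //.
  have -> : gamma / 8 * (gamma * d) = 64 * (gamma ^+ 2 * d / 512) by field.
  by rewrite ler_pM2l.
(* The 64 in [lambda] divided by 4 gives the exponent 16. *)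
have rate : expR (- (gamma * lambda * d / 4)) = (zeta / 2) ^+ 16.
  rewrite -aE -expRM_natl; congr expR; rewrite /lambda; field.
  by rewrite !lt0r_neq0.
have a_ge0 : 0 <= zeta / 2 by rewrite divr_ge0 // ltW.
have private := sbm_mechanism_private (n := n) d lambda_ge0 eps_ge.
have growth : (1 + zeta / 2) ^+ n <= expR (zeta / 2 * n%:R).
  by rewrite expRM_natr lerXn2r ?nnegrE ?addr_ge0 ?expR_ge0 ?expR_ge1Dx.
split=> [_|]; exists (sbm_mechanism d lambda); split=> // x valid bal.
  (* The exponential cancels [growth], so the total failure probability is at most [zeta]. *)
  set B := zeta / 2 * expR (- (zeta / 2 * n%:R)).
  have B_ge0 : 0 <= B by rewrite mulr_ge0 ?expR_ge0.
  apply: le_trans (mechanism_accuracy valid n_gt0 d_gt0 lambda_ge0 lambda_le bal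
    a_ge0 B_ge0 rate _).
    rewrite lerD2l lerN2; apply: le_trans (ler_wpM2l _ growth) _.
      by rewrite mulr_ge0.
    have -> : 2 * B * expR (zeta / 2 * n%:R)
        = zeta * (expR (- (zeta / 2 * n%:R)) * expR (zeta / 2 * n%:R)).
      by rewrite /B; field.
    by rewrite -expRD addNr expR0 mulr1.
  move=> k k_gt.
  (* Then [k * l] covers the factor [zeta / 2] of [B], and another [k * l >= k / 2 > zeta * n / 2]
     covers its exponential. *)
  have k_ge1 : 1 <= k%:R :> R.
    rewrite ler1n lt0n; apply: contraTneq k_gt => ->.
    by rewrite -leNgt mulr_ge0 ?ler0n // ltW.
  rewrite /B -aE -expRM_natl -expRD ler_expR natrM aE.
  have := ler_wpM2l (le_trans ler01 k_ge1) l_ge.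
  have : l <= k%:R * l by rewrite ler_peMl //; lra.
  lra.
set L := ln (1 / zeta).
have L_gt0 : 0 < L by rewrite ln_gt0 // ltr_pdivlMr // mul1r.
have L_le : L <= l.
  by rewrite ler_ln ?posrE ?divr_gt0 // ler_wpM2r ?invr_ge0 ?(ltW zeta_gt0) // ler1n.
have sqrtL_gt0 : 0 < Num.sqrt L by rewrite sqrtr_gt0.
(* [L <= l <= 4 * l ^+ 2], because [l >= 1 / 2]. *)
have sqrtL_le : Num.sqrt L <= 2 * l.
  rewrite -(@ger0_norm _ (2 * l)) -?sqrtr_sqr ?ler_wsqrtr //; nra.
set theta := 20 / Num.sqrt L.
have theta_l : 10 <= theta * l.
  by rewrite /theta mulrAC ler_pdivlMr //; lra.
(* The exponent is 15 times the bound 10 on [theta * l], per vertex. *)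
set B := expR (- (150 * n%:R)) : R.
apply: le_trans (mechanism_accuracy valid n_gt0 d_gt0 lambda_ge0 lambda_le bal
  a_ge0 (expR_ge0 _ : 0 <= B) rate _).
  rewrite lerD2l lerN2; apply: le_trans (ler_wpM2l _ growth) _.
    by rewrite mulr_ge0 ?expR_ge0.
  have n_ge1 : 1 <= n%:R :> R by rewrite ler1n.
  (* Bounding 2 by [expR 1] leaves only exponents to compare: [1 + n - 150 * n <= - n]. *)
  apply: le_trans (_ : expR 1 * B * expR (zeta / 2 * n%:R) <= _).
    by rewrite !ler_wpM2r ?expR_ge0 // (le_trans _ (expR_ge1Dx 1)) //; lra.
  rewrite -!expRD ler_expR.
  have : zeta / 2 * n%:R <= 1 * n%:R by rewrite ler_wpM2r ?ler0n //; lra.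
  lra.
move=> k k_gt.
rewrite /B -aE -expRM_natl ler_expR natrM.
have : theta * n%:R * l <= k%:R * l by rewrite ler_wpM2r ?(ltW k_gt) //; lra.
have : 10 * n%:R <= theta * l * n%:R by rewrite ler_wpM2r ?ler0n.
lra.
Qed.
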